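(* Let $I$ be a non-empty descent set, $s=s(I)$, $w=w(I)$, and $(C_0,\ldots,C_s)$ its Naruse-Newton coefficients. Then $$\frac{C_0}{0!}=\frac{C_1}{1!}=\cdots=\frac{C_w}{w!}>\frac{C_{w+1}}{(w+1)!}>\cdots>\frac{C_s}{s!};$$ that is, $\frac{C_j}{j!}=\frac{C_{j+1}}{(j+1)!}$ for all integers $0\le j<\min(w,s)$, and $\frac{C_j}{j!}>\frac{C_{j+1}}{(j+1)!}$ for all integers $w\le j<s$.
   Context: Partitions are drawn as Young diagrams $\mathbb{D}(\lambda)$ in English notation; $c_{i,j}$ is the cell in row $i$, column $j$; $\lambda'$ is the conjugate partition ($\lambda'_j$ = number of cells in column $j$). The hook length $h_\lambda(c)$ is the number of cells of $\mathbb{D}(\lambda)$ weakly right of $c$ in its row or weakly below $c$ in its column (counting $c$ once). For $\mu\subseteq\lambda$, an excited diagram of $\lambda/\mu$ is a subset of $\mathbb{D}(\lambda)$ obtained from $\mathbb{D}(\mu)$ by repeatedly replacing a cell $c_{i,j}\in D$ by $c_{i+1,j+1}$, allowed iff $c_{i+1,j+1}\in\mathbb{D}(\lambda)$ and none of $c_{i,j+1},c_{i+1,j},c_{i+1,j+1}$ lies in $D$; $\mathbb{E}(\lambda/\mu)$ is their set. A ribbon with $n$ cells is read from its lower-left to its upper-right cell, each successive cell directly right of or directly above the previous; it corresponds to the set of $i\in\{1,\ldots,n-1\}$ with cell $i$ directly below cell $i+1$. A descent set is a non-empty finite set $I$ of positive integers; $\lambda^I$ is the unique partition with $\lambda^I_1=\lambda^I_2$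 such that the cells $c_{i,j}\in\mathbb{D}(\lambda^I)$ with fewer than three of $c_{i,j+1},c_{i+1,j},c_{i+1,j+1}$ in $\mathbb{D}(\lambda^I)$ form a ribbon corresponding to $I$; this ribbon is $\mathbb{D}(\lambda^I)\setminus\mathbb{D}(\mu^I)$ for a partition $\mu^I$. Let $s(I)=\lambda^I_1-1$. Naruse-Newton coefficients: every excited diagram of $\lambda^I/\mu^I$ meets row 1 in $\{c_{1,1},\ldots,c_{1,r}\}$, $0\le r\le s$; for $0\le j\le s(I)$, $C_j(I)=\sum_D\prod_{c\in D,\,c\notin\text{row }1}h_{\lambda^I}(c)$, summed over $D\in\mathbb{E}(\lambda^I/\mu^I)$ with exactly $s-j$ cells in row 1. $w(I)$ is the number of integers $j$ with $1\le j\le s(I)+1$ and $(\lambda^I)'_j=2$. *)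

(* Defs.v *)
(* Cells are pairs (row, column) of nats, 1-indexed, English notation. *)
From HB Require Import structures.
From mathcomp Require Import all_boot all_order all_algebra finmap.
Set Implicit Arguments. Unset Strict Implicit. Unset Printing Implicit Defensive.

Definition is_partition (l : seq nat) : bool := sorted geq l && all (fun x => 0 < x) l.

(* lambda_i, 1-indexed (0 for i = 0 or i > length). *)
Definition part (l : seq nat) (i : nat) : nat := if i is i'.+1 then nth 0 l i' else 0.

Definition conj_part (l : seq nat) (j : nat) : nat := count (fun x => j <= x) l.

Definition in_diagram (l : seq nat) (c : nat * nat) : bool :=
  [&& 1 <= c.1, 1 <= c.2 & c.2 <= part l c.1].

(* hook length: (lambda_i - j) cells to the right, (lambda'_j - i) below, plus c *)
Definition hook (l : seq nat) (c : nat * nat) : nat :=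
  (part l c.1 - c.2) + (conj_part l c.2 - c.1) + 1.

(* A finite type of cells large enough to contain D(lambda) *)
Definition cbound (l : seq nat) : nat := (size l + head 0 l).+1.
Definition cell (l : seq nat) := ('I_(cbound l) * 'I_(cbound l))%type.
Definition cnat (l : seq nat) (c : cell l) : nat * nat := (nat_of_ord c.1, nat_of_ord c.2).

Definition diagram_set (l m : seq nat) : {set cell l} :=
  [set c : cell l | in_diagram m (cnat c)].

Definition excited_move (l : seq nat) (D D' : {set cell l}) : bool :=
  [exists c in D, exists d : cell l,
    [&& cnat d == ((cnat c).1.+1, (cnat c).2.+1),
        in_diagram l (cnat d),
        [forall e in D, cnat e \notin
            [:: ((cnat c).1, (cnat c).2.+1); ((cnat c).1.+1, (cnat c).2); cnat d]]
      & D' == d |: (D :\ c)]].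

Definition excited_diagrams (l m : seq nat) : {set {set cell l}} :=
  [set D | connect (@excited_move l) (diagram_set l m) D].

Definition outer (l : seq nat) (c : nat * nat) : bool :=
  in_diagram l c &&
  (count (in_diagram l) [:: (c.1, c.2.+1); (c.1.+1, c.2); (c.1.+1, c.2.+1)] < 3).

Definition ribbon_step (a b : nat * nat) : bool :=
  (b == (a.1, a.2.+1)) || ((b.1.+1 == a.1) && (b.2 == a.2)).

Definition below (a b : nat * nat) : bool := (a.1 == b.1.+1) && (a.2 == b.2).

Local Open Scope fset_scope.

(* The set of cells S is a ribbon (read lower-left to upper-right as r_1,...,r_n)
   whose corresponding set {i in 1..n-1 | cell i directly below cell i+1} is I. *)
Definition ribbon_of (S : pred (nat * nat)) (I : {fset nat}) : Prop :=
  exists r : seq (nat * nat),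
    [/\ r != [::], uniq r, (forall c, S c = (c \in r)),
        sorted ribbon_step r &
        (forall k, (k \in I) = (0 < k < size r) && below (nth (0,0) r k.-1) (nth (0,0) r k))].

Definition s_of (l : seq nat) : nat := part l 1 - 1.

Definition w_of (l : seq nat) : nat :=
  count (fun j => conj_part l j == 2) (iota 1 (s_of l).+1).

Definition row1_count (l : seq nat) (D : {set cell l}) : nat :=
  #|[set c in D | (cnat c).1 == 1]|.

Definition NNcoef (l m : seq nat) (j : nat) : nat :=
  \sum_(D in excited_diagrams l m | row1_count D == s_of l - j)
     \prod_(c in D | (cnat c).1 != 1) hook l (cnat c).

(* Main.v *)
(* An excited diagram of lambda/mu is the complement in lambda of a lattice path
   running from the bottom of column 1 to the end of row 1; if the path leaves
   row i upwards in column p_i, an excited move decrements one p_i.  Fixing the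
   number of row-1 cells fixes p_2, so C_j is a weighted sum Z(k) over paths of
   nu = (lambda_2, lambda_3, ...) ending in column k = s - j + 1 of its first row.
   With H the product of the hooks of the first row of nu and Z' the path sum of
   nu minus its first row, splitting off the last step gives
     h(1,k) Z(k) = Z(k-1) + H Z'(k),   h(1,k) = (j + 1) + leg(1,k),
   so (j + 1) C_j - C_{j+1} = H Z'(k) - leg(1,k) Z(k).  Both terms vanish when
   leg(1,k) = 0, i.e. when j < w; otherwise the difference is positive, by
   induction on the rows and on k. *)
Require Import Defs.
From HB Require Import structures.
From mathcomp Require Import all_boot all_order all_algebra finmap.
From mathcomp Require Import zify.
Import Order.TTheory GRing.Theory Num.Theory.

(** * Lattice paths in a diagram and their weights *)

(* A lattice path is the sequence p of the columns in which it leaves each row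
   upwards, listed from the top row; the default 1 of [nth] is the column where
   it starts below the last row.  Rows are 0-indexed here (row i of p is row
   i.+1 of the diagram), and [path_cond p i j] says that cell j of row i is off
   the path. *)
Definition path_cond (p : seq nat) (i j : nat) : bool :=
  (j < nth 1 p i.+1) || (nth 1 p i < j).

Definition path_weight (l p : seq nat) : nat :=
  \prod_(0 <= i < size l)
    \prod_(1 <= j < (nth 0 l i).+1 | path_cond p i j) hook l (i.+1, j).

(** Here [a] is the column in which the path enters the top row. With no row left the path stands in
    its starting column 1, so the term [a = 0] is always empty; it lets recurrences in [k] start at
    column 0. *)
Fixpoint paths (l : seq nat) (k : nat) : seq (seq nat) :=
  if l is x :: l' then
    if k <= x then [seq k :: q | a <- index_iota 0 k.+1, q <- paths l' a] else [::]
  else if k == 1 then [:: [::]] else [::].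

Lemma paths_cons x l k : paths (x :: l) k =
  if k <= x then [seq k :: q | a <- index_iota 0 k.+1, q <- paths l a] else [::].
Proof. by []. Qed.

Definition path_sum (l : seq nat) (k : nat) : nat :=
  \sum_(p <- paths l k) path_weight l p.

(** * Partitions and hooks under removal of the first row *)

Lemma is_partition_cons x l :
  is_partition (x :: l) = [&& 0 < x, head 0 l <= x & is_partition l].
Proof.
rewrite /is_partition; case: l => [|y l] /=; first by rewrite !andbT.
by case: (0 < x); case: (y <= x); rewrite /= ?andbF.
Qed.

Lemma partition_nth l i : is_partition l -> nth 0 l i.+1 <= nth 0 l i.
Proof.
elim: l i => [|x l IH] [|i] //; rewrite is_partition_cons => /and3P[_ h pl] /=.
  by rewrite nth0.
exact: IH.
Qed.

Lemma partition_nth_gt0 l i : is_partition l -> i < size l -> 0 < nth 0 l i.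
Proof. by case/andP=> _ /all_nthP h hi; exact: h. Qed.

Lemma partition_nth_head l i : is_partition l -> nth 0 l i <= head 0 l.
Proof.
move=> pl; elim: i => [|i IH]; first by rewrite nth0.
exact: leq_trans (partition_nth _ _ pl) IH.
Qed.

Lemma conj_part_eq0 l k :
  is_partition l -> 0 < k -> (conj_part l k == 0) = (head 0 l < k).
Proof.
move=> + k0; elim: l => [|x l IH]; first by rewrite k0.
rewrite is_partition_cons /conj_part /= => /and3P[_ h /IH].
by rewrite -/(conj_part l k); lia.
Qed.

Lemma conj_part_mono l k : conj_part l k.+1 <= conj_part l k.
Proof. by apply: sub_count => x; exact: ltnW. Qed.

Lemma conj_part_cons x l j : j <= x -> conj_part (x :: l) j = (conj_part l j).+1.
Proof. by rewrite /conj_part /= => ->. Qed.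

Lemma hook_cons x l i j : j <= x -> hook (x :: l) (i.+2, j) = hook l (i.+1, j).
Proof. by move=> h; rewrite /hook [(_,_).2]/= conj_part_cons. Qed.

Lemma hook_cons1 x l j :
  j <= x -> hook (x :: l) (1, j) = x - j + conj_part l j + 1.
Proof. by move=> h; rewrite /hook [(_,_).2]/= conj_part_cons // subn1. Qed.

(** * Recurrence and positivity of path sums *)

Lemma path_weight_shift x l p q :
  is_partition (x :: l) -> (forall i, nth 1 p i.+1 = nth 1 q i) ->
  \prod_(1 <= i < (size l).+1) \prod_(1 <= j < (nth 0 (x :: l) i).+1 | path_cond p i j)
     hook (x :: l) (i.+1, j) = path_weight l q.
Proof.
rewrite is_partition_cons => /and3P[_ h pl] hq.
rewrite big_add1 /=; apply: eq_bigr => i _.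
apply: congr_big_nat => //= j hj; rewrite ?/path_cond ?hq //.
rewrite hook_cons //; have := partition_nth_head _ i pl; lia.
Qed.

Lemma path_weight_cons x l k q : is_partition (x :: l) ->
  path_weight (x :: l) (k :: q) =
  (\prod_(1 <= j < x.+1 | (j < head 1 q) || (k < j)) hook (x :: l) (1, j))
    * path_weight l q.
Proof.
move=> pl; by rewrite -(@path_weight_shift x l (k :: q) q) // /path_weight big_ltn.
Qed.

Lemma head_paths l k p : p \in paths l k -> head 1 p = k.
Proof.
case: l => [|x l]; first by rewrite /=; case: eqP => // ->; rewrite inE => /eqP->.
rewrite paths_cons.
by case: leqP => // _ /allpairsPdep[a [q [_ _ ->]]].
Qed.

Lemma path_sum_cons x l k : is_partition (x :: l) -> k <= x ->
  path_sum (x :: l) k =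
  \sum_(0 <= a < k.+1)
    path_sum l a * \prod_(1 <= j < x.+1 | (j < a) || (k < j)) hook (x :: l) (1, j).
Proof.
move=> pl hk; rewrite /path_sum paths_cons hk big_allpairs_dep.
apply: eq_bigr => a _; rewrite big_distrl /= !big_seq; apply: eq_bigr => q hq.
by rewrite path_weight_cons // (head_paths _ _ _ hq) mulnC.
Qed.

Lemma prod_nat_extract (m n : nat) (P Q : pred nat) (F : nat -> nat) :
  0 < m < n -> (forall j, Q j && (j != m) = P j) -> Q m ->
  \prod_(1 <= j < n | Q j) F j = F m * \prod_(1 <= j < n | P j) F j.
Proof.
move=> hm hP Qm; rewrite big_mkcond (bigD1_seq m) ?mem_index_iota ?iota_uniq //= Qm.
by congr muln; rewrite -big_mkcondr; apply: eq_bigl => j; rewrite andbC.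
Qed.

Definition hook_row (l : seq nat) : nat := \prod_(1 <= j < (head 0 l).+1) hook l (1, j).

Lemma hook_gt0 l c : 0 < hook l c.
Proof. by rewrite /hook addn1. Qed.

(** A path to [k.+1] that enters the top row at [a <= k] extends a path to [k] by one cell, whose
    hook thereby leaves the weight. A path entering at [k.+1] has only this cell in the row, and its
    hook completes the row product to [hook_row]. *)
Lemma path_sum_rec x l k : is_partition (x :: l) -> k < x ->
  hook (x :: l) (1, k.+1) * path_sum (x :: l) k.+1 =
  path_sum (x :: l) k + hook_row (x :: l) * path_sum l k.+1.
Proof.
move=> pl hk; rewrite !path_sum_cons ?(ltnW hk) // big_nat_recr //= mulnDr; congr addn.
  rewrite big_distrr /= !big_nat; apply: eq_bigr => a ha.
  rewrite mulnCA -(@prod_nat_extract k.+1 _ _ (fun j => (j < a) || (k < j))) //=.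
    by lia.
  by rewrite ltnSn orbT.
rewrite mulnCA mulnC -(@prod_nat_extract k.+1 _ _ xpredT) //=; lia.
Qed.

Lemma path_sum0 l : is_partition l -> path_sum l 0 = 0.
Proof.
elim: l => [|x l IH] pl; first by rewrite /path_sum big_nil.
rewrite path_sum_cons // big_nat1 IH //.
by move: pl; rewrite is_partition_cons => /and3P[].
Qed.

Lemma path_sum_out l k : (head 1 l < k) -> path_sum l k = 0.
Proof.
case: l => [|x l] /= h; rewrite /path_sum ?paths_cons.
  by rewrite /=; case: eqP h => [->|] // _ _; rewrite big_nil.
by rewrite leqNgt h big_nil.
Qed.

(** The path that climbs column 1 and turns right only in the top row contributes a positive
    weight. *)
Lemma path_sum_gt0 l k : is_partition l -> 0 < k <= head 1 l -> 0 < path_sum l k.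
Proof.
elim: l k => [|x l IH] k pl /= hk.
  by have -> : k = 1 by [lia]; rewrite /path_sum big_seq1 /path_weight big_nil.
have pl' : is_partition l by move: pl; rewrite is_partition_cons => /and3P[].
have h1 : 0 < path_sum l 1.
  by apply: IH => //; case: l pl' {pl} => //= y l; rewrite is_partition_cons => /and3P[].
rewrite path_sum_cons //; last by lia.
rewrite (bigD1_seq 1) ?mem_index_iota ?iota_uniq //=; last by lia.
rewrite ltn_addr // muln_gt0 h1 /=.
by apply: prodn_cond_gt0 => j _; exact: hook_gt0.
Qed.

(** * The strict inequality for positive legs *)

Lemma hook_row_gt0 l : 0 < hook_row l.
Proof. by apply: prodn_gt0 => j; exact: hook_gt0. Qed.

(* At a cell with arm + 1 = m and leg = c: B and A are the contributions to G of
   paths coming from the left and from below; L and M play the roles of c and m at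
   the left and lower neighbours. *)
Lemma arm_leg_bound (L M m c A B G : nat) :
  c <= L -> M <= m -> (m + c) * G = B + A -> L * B < M * A -> c * G < A.
Proof.
move=> cL Mm hG hB; rewrite ltnNge; apply/negP => AcG.
(* If [A <= c * G], then L(m+c)G < (M+L)A <= (m+L)cG <= L(m+c)G, the last step because c <= L. *)
have h1 : L * ((m + c) * G) < (M + L) * A by rewrite hG mulnDr mulnDl ltn_add2r.
have h2 : (M + L) * A <= (m + L) * (c * G) by rewrite leq_mul // leq_add2r.
have h3 : (m + L) * (c * G) <= L * ((m + c) * G).
  rewrite !mulnA leq_mul // mulnDl mulnDr leq_add2r mulnC leq_mul //.
by move: (leq_trans h1 (leq_trans h2 h3)); rewrite ltnn.
Qed.

(** Outer induction on the rows, inner induction on [k]. In [arm_leg_bound], L is the leg in column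
    [k] and M = [y - k] is one more than the arm of the lower neighbour. Its hypothesis L B < M A
    chains the claim at [k] with a bound on [path_sum (y :: l) k] one row down. *)
Lemma path_sum_lt x l k : is_partition (x :: l) -> 0 < k <= x -> 0 < conj_part l k ->
  conj_part l k * path_sum (x :: l) k < hook_row (x :: l) * path_sum l k.
Proof.
elim: l x k => [|y l IHl] x k // pl; elim: k => [|k IHk] // hk hc.
have pl' : is_partition (y :: l) by move: pl; rewrite is_partition_cons => /and3P[].
have hxy : y <= x by move: pl; rewrite is_partition_cons => /and3P[].
have hky : k < y.
  by have := conj_part_eq0 _ k.+1 pl' isT; rewrite [head _ _]/=; lia.
have := path_sum_rec _ _ _ pl hk; rewrite hook_cons1 //.
have := path_sum_rec _ _ _ pl' hky; rewrite hook_cons1 //.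
(* Only the weak inequality is wanted here, so a zero leg is harmless. *)
have IH' : conj_part l k.+1 * path_sum (y :: l) k.+1 <= hook_row (y :: l) * path_sum l k.+1.
  case: (posnP (conj_part l k.+1)) => [->|h] //; exact/ltnW/IHl.
have A0 : 0 < path_sum (y :: l) k.+1 by apply: path_sum_gt0.
have H0 := hook_row_gt0 (x :: y :: l).
rewrite !addn1 -!addSn !subnSK; [|lia|lia] => rec' rec.
apply: (@arm_leg_bound _ (y - k)) rec _; [exact: conj_part_mono|exact: leq_sub2r|].
rewrite mulnCA.
(* By [IH'], the leg part of the hook in [rec'] is absorbed by the [hook_row] term. *)
have h1 : path_sum (y :: l) k <= (y - k) * path_sum (y :: l) k.+1.
  by move: rec'; rewrite mulnDl; lia.
(* No path comes from column 0, so for [k = 0] only positivity of the right-hand side remains. *)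
case: k hk hc hky IHk {IH' rec'} A0 h1 => [|k] hk hc hky IHk A0 h1.
  by rewrite path_sum0 // muln0 subn0 !muln_gt0 A0 H0 hky.
apply: leq_trans (IHk _ _) _; first by lia.
  by apply: leq_trans hc _; exact: conj_part_mono.
by rewrite leq_mul2l h1 orbT.
Qed.

(** * Paths as monotone sequences of columns *)

Definition path_seq (l p : seq nat) : bool :=
  (size p == size l) &&
  all (fun i => nth 1 p i.+1 <= nth 1 p i <= nth 0 l i) (iota 0 (size l)).

Lemma path_seqP l p :
  reflect (size p = size l /\
           forall i, i < size l -> nth 1 p i.+1 <= nth 1 p i <= nth 0 l i)
          (path_seq l p).
Proof.
apply: (iffP andP) => [[/eqP sp /allP h]|[sp h]]; split=> //; last 2 first.
- exact/eqP.
- by apply/allP => i; rewrite mem_iota add0n; exact: h.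
by move=> i hi; apply: h; rewrite mem_iota.
Qed.

Lemma path_seq_cons x l k q :
  path_seq (x :: l) (k :: q) = (head 1 q <= k <= x) && path_seq l q.
Proof.
rewrite /path_seq /= eqSS -nth0 -[1%N]/(1 + 0)%N iotaDl all_map.
by rewrite andbCA.
Qed.

(** The inequality for the last row compares with the default 1, and the entries weakly increase
    upwards. *)
Lemma path_seq_gt0 l p i : path_seq l p -> 0 < nth 1 p i.
Proof.
elim: l p i => [|x l IH] [|k q] i //; first by rewrite nth_nil.
rewrite path_seq_cons => /andP[hk hq]; case: i => [|i] /=; last exact: IH.
by have := IH _ 0 hq; rewrite nth0; lia.
Qed.

Lemma mem_paths l k p : (p \in paths l k) = path_seq l p && (head 1 p == k).
Proof.
elim: l k p => [|x l IH] k p.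
  case: p => [|y p] /=; first by rewrite eq_sym; case: eqP.
  by case: ifP.
rewrite paths_cons; case: p => [|y p].
  by case: ifP => // _; apply/negbTE/allpairsPdep => -[a [q [_ _]]].
rewrite path_seq_cons [head 1 (y :: p)]/=; case: (leqP k x) => hk; last by rewrite in_nil; lia.
apply/allpairsPdep/andP => [[a [q [ha]]]|[/andP[h1 h2] /eqP <-]].
  rewrite IH mem_index_iota in ha * => /andP[hq /eqP hh] [-> ->].
  by rewrite hq hh; split => //; lia.
exists (head 1 p), p; rewrite IH h2 mem_index_iota eqxx; split=> //; lia.
Qed.

Lemma paths_uniq l k : uniq (paths l k).
Proof.
elim: l k => [|x l IH] k; first by rewrite /=; case: ifP.
rewrite paths_cons; case: ifP => // _.
apply: allpairs_uniq_dep; [exact: iota_uniq | by move=> a _; exact: IH|].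
move=> _ _ /allpairsPdep[a [q [_ hq ->]]] /allpairsPdep[b [r [_ hr ->]]] /= [eqr].
by move: hq hr; rewrite eqr !mem_paths => /andP[_ /eqP->] /andP[_ /eqP->].
Qed.

(** * Excited diagrams as complements of paths *)

Definition path_cell (l p : seq nat) (c : nat * nat) : bool :=
  in_diagram l c && path_cond p c.1.-1 c.2.

Definition path_set (l p : seq nat) : {set cell l} :=
  [set c | path_cell l p (cnat c)].

Lemma cnat_inj l : injective (@cnat l).
Proof. by move=> [a b] [c d] [] /val_inj -> /val_inj ->. Qed.

Lemma in_diagramS l i j : in_diagram l (i.+1, j) = (0 < j <= nth 0 l i).
Proof. by []. Qed.

Lemma in_diagram_row l i j : in_diagram l (i.+1, j) -> i < size l.
Proof. by rewrite in_diagramS; case: (ltnP i (size l)) => // h; rewrite nth_default; lia. Qed.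

Lemma in_diagram_cell l x : is_partition l -> in_diagram l x ->
  exists c : cell l, cnat c = x.
Proof.
case: x => [[|i] j] // pl h.
have hi : i.+1 < cbound l by have := in_diagram_row _ _ _ h; rewrite /cbound; lia.
have hj : j < cbound l.
  by move: h (partition_nth_head _ i pl); rewrite in_diagramS /cbound; lia.
by exists (Ordinal hi, Ordinal hj).
Qed.

(** A path occupies row [i] (0-indexed) from column p_{i+1} to column p_i. Lowering p_{i+1} from
    [v.+1] to [v] puts cell [v] of that row on the path and takes cell [v.+1] of the next row off
    it. *)
Lemma path_cell_shift l p q i v : is_partition l -> path_seq l p -> path_seq l q ->
  i.+1 < size l -> nth 1 p i.+1 = v.+1 -> nth 1 q i.+1 = v ->
  (forall r, r != i.+1 -> nth 1 q r = nth 1 p r) ->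
  forall c, path_cell l q c =
    (c == (i.+2, v.+1)) || (path_cell l p c && (c != (i.+1, v))).
Proof.
move=> pl /path_seqP[_ hp] /path_seqP[_ hq] hi pv qv hr [[|r] j] //.
rewrite /path_cell in_diagramS /path_cond /= !xpair_eqE !eqSS.
have li := partition_nth l i pl.
have := hp _ hi; have := hq _ hi; have := hp _ (ltnW hi); rewrite pv qv.
rewrite hr; last by lia.
case: (eqVneq r i) => [->|ri]; first by rewrite pv qv hr; lia.
case: (eqVneq r i.+1) => [->|ri1]; first by rewrite pv qv hr; lia.
rewrite !hr //; lia.
Qed.

Lemma path_set_shift l p q i v (c d : cell l) :
  is_partition l -> path_seq l p -> path_seq l q ->
  i.+1 < size l -> nth 1 p i.+1 = v.+1 -> nth 1 q i.+1 = v ->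
  (forall r, r != i.+1 -> nth 1 q r = nth 1 p r) ->
  cnat c = (i.+1, v) -> cnat d = (i.+2, v.+1) ->
  path_set l q = d |: (path_set l p :\ c).
Proof.
move=> pl vp vq hi pv qv hr hc hd; apply/setP => e.
rewrite !inE (path_cell_shift l p q i v) // -hd -hc !(inj_eq (@cnat_inj l)).
by rewrite andbC.
Qed.

Lemma excited_move_path l p D : is_partition l -> path_seq l p ->
  excited_move (path_set l p) D ->
  exists q, [/\ path_seq l q, head 1 q = head 1 p & D = path_set l q].
Proof.
move=> pl vp /existsP[c /andP[cD /existsP[d /and4P[/eqP hd dl /forallP hno /eqP ->]]]].
have no x : path_cell l p x ->
    x \notin [:: ((cnat c).1, (cnat c).2.+1); ((cnat c).1.+1, (cnat c).2); cnat d].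
  move=> hx; case: (in_diagram_cell l x pl); first by case/andP: hx.
  by move=> e ex; have := hno e; rewrite inE ex hx.
move: cD no dl; rewrite inE hd; case E : (cnat c) => [[|i] j] //= cD no dl.
have hi := in_diagram_row _ _ _ dl.
have no1 := no (i.+1, j.+1); have no2 := no (i.+2, j).
have li := partition_nth l i pl.
move: no1 no2; rewrite !inE !eqxx ?orbT /= => no1 no2.
have {no1} h1 : ~~ path_cond p i j.+1.
  apply/negP => h; suff: false by []; apply: no1.
  by rewrite /path_cell in_diagramS h; move: dl; rewrite in_diagramS; lia.
have {no2} h2 : ~~ path_cond p i.+1 j.
  apply/negP => h; suff: false by []; apply: no2.
  by move: cD dl; rewrite /path_cell !in_diagramS h; lia.
move: cD; rewrite /path_cell in_diagramS /= => cD.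
(* The cell in column [j] is off the path and its right neighbour is on it, so the path enters this
   row at [j.+1]. *)
have pj : nth 1 p i.+1 = j.+1 by move: cD h1; rewrite /path_cond; lia.
have hr r : r != i.+1 -> nth 1 (set_nth 1 p i.+1 j) r = nth 1 p r.
  by rewrite nth_set_nth /= => /negbTE->.
have qj : nth 1 (set_nth 1 p i.+1 j) i.+1 = j by rewrite nth_set_nth /= eqxx.
have vq : path_seq l (set_nth 1 p i.+1 j).
  case/path_seqP: (vp) => sp hp; apply/path_seqP; split.
    by rewrite size_set_nth sp; apply/maxn_idPr.
  move=> r hrl; have := hp r hrl.
  case: (eqVneq r i.+1) => [->|r1].
    rewrite qj hr ?pj; last by lia.
    (* The lower neighbour is on the path, so the row below is entered at column [j] or earlier and
       the lowered entry is still admissible. *)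
    by move: h2; rewrite /path_cond; lia.
  rewrite (hr r) //; case: (eqVneq r i) => [->|r2]; first by rewrite qj pj; lia.
  by rewrite hr //; lia.
exists (set_nth 1 p i.+1 j); split=> //; first by case: (p).
by symmetry; apply: (@path_set_shift l p _ i j); rewrite // hd E.
Qed.

Lemma path_seq_self l : is_partition l -> path_seq l l.
Proof.
move=> pl; apply/path_seqP; split=> // i hi.
have := partition_nth_gt0 _ _ pl hi; have := partition_nth l i pl.
rewrite (set_nth_default 0 1 hi).
case: (ltnP i.+1 (size l)) => h; first by rewrite (set_nth_default 0 1 h); lia.
by rewrite (nth_default 1 h); lia.
Qed.

Lemma diagram_set_path l m : is_partition l ->
  (forall c, in_diagram m c = in_diagram l c && ~~ outer l c) ->
  diagram_set l m = path_set l l.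
Proof.
move=> pl hm; apply/setP => c; rewrite !inE hm /outer /path_cell.
case: (cnat c) => [[|i] j] //; case hc : (in_diagram l _) => //=.
have hi := in_diagram_row _ _ _ hc; move: hc.
rewrite !in_diagramS /path_cond (set_nth_default 0 1 hi).
have := partition_nth l i pl.
case: (ltnP i.+1 (size l)) => h; first by rewrite (set_nth_default 0 1 h); lia.
(* In the last row every cell is outer, and the default 1 puts all of them on the path. *)
by rewrite (nth_default 1 h) (nth_default 0 h); lia.
Qed.

(** Induction on the total distance of [p] from [l]. At the first row where [p] falls short of [l],
    raising the entry by one keeps a path, since the entry above is maximal; one excited move leads
    from the raised path [q] back to [p]. *)
Lemma path_set_connect l p : is_partition l -> path_seq l p -> head 1 p = head 1 l ->
  connect (@excited_move l) (path_set l l) (path_set l p).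
Proof.
move=> pl; have [n] := ubnP (\sum_(i < size l) (nth 0 l i - nth 1 p i)).
elim: n p => // n IH p; rewrite ltnS => hn vp hp.
case/path_seqP: (vp) => sp hvp.
have [/hasP[i0]|/hasPn hall] :=
  boolP (has (fun i => nth 1 p i < nth 0 l i) (iota 0 (size l))); last first.
  suff -> : p = l by exact: connect0.
  apply: (@eq_from_nth _ 1) => // i; rewrite sp => hi.
  have := hall i; rewrite mem_iota => /(_ hi); have := hvp i hi.
  by rewrite (set_nth_default 0 1 hi); lia.
rewrite mem_iota /= => hi0 lt0.
have ex : exists i, (i < size l) && (nth 1 p i < nth 0 l i) by exists i0; rewrite hi0.
case: (ex_minnP ex) => -[|i] /andP[hi lti] mini {i0 hi0 lt0 ex}.
  by move: lti; rewrite -(set_nth_default 0 1 hi) !nth0 hp ltnn.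
have pli : nth 1 p i = nth 0 l i.
  have := hvp i (ltnW hi); have := mini i; rewrite (ltnW hi) /=.
  by case: (ltnP (nth 1 p i)) => [_ /(_ isT)|]; lia.
set v := nth 1 p i.+1 in lti.
pose q := set_nth 1 p i.+1 v.+1.
have hr r : r != i.+1 -> nth 1 q r = nth 1 p r.
  by rewrite nth_set_nth /= => /negbTE->.
have qv : nth 1 q i.+1 = v.+1 by rewrite nth_set_nth /= eqxx.
have li := partition_nth l i pl.
have vq : path_seq l q.
  apply/path_seqP; split; first by rewrite size_set_nth sp; apply/maxn_idPr.
  move=> r hrl; have := hvp r hrl.
  case: (eqVneq r i.+1) => [->|r1]; first by rewrite qv hr -?/v; lia.
  rewrite (hr r) //; case: (eqVneq r i) => [->|r2]; first by rewrite qv pli; lia.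
  by rewrite hr //; lia.
have v0 : 0 < v by exact: path_seq_gt0 vp.
have cl : in_diagram l (i.+1, v) by rewrite in_diagramS; lia.
have dl : in_diagram l (i.+2, v.+1) by rewrite in_diagramS; lia.
have [c hc] := in_diagram_cell _ _ pl cl; have [d hd] := in_diagram_cell _ _ pl dl.
apply: connect_trans (IH q _ vq _) (connect1 _); last 1 first.
- apply/existsP; exists c; rewrite inE hc /path_cell cl /path_cond /= qv ltnSn /=.
  apply/existsP; exists d; rewrite hd eqxx dl /=; apply/andP; split.
    apply/forallP => e; apply/implyP; rewrite inE /path_cell !inE !negb_or.
    have := hvp _ hi; have := hvp _ (ltnW hi); rewrite -/v => hh1 hh2.
    move=> /andP[_]; case: (cnat e) => a b; rewrite !xpair_eqE /path_cond /=.
    move=> h; apply/and3P; split; apply/negP => /andP[/eqP ea /eqP eb]; move: h;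
      rewrite ea eb /= ?qv ?hr //; lia.
  apply/eqP; apply: (@path_set_shift l q p i v) => // r /hr ->//.
- apply: leq_trans hn.
  rewrite (bigD1 (Ordinal hi)) //= [X in _ < X](bigD1 (Ordinal hi)) //= qv -/v.
  rewrite -addSn leq_add //; first by lia.
  by apply: leq_sum => r hrr; rewrite hr //.
- by rewrite -hp /q; case: (p).
Qed.

Lemma mem_excited_diagrams l m D : is_partition l ->
  (forall c, in_diagram m c = in_diagram l c && ~~ outer l c) ->
  reflect (exists p, [/\ path_seq l p, head 1 p = head 1 l & D = path_set l p])
          (D \in excited_diagrams l m).
Proof.
move=> pl hm; rewrite inE (diagram_set_path _ _ pl hm).
apply: (iffP idP) => [/connectP[s hs ->]|[p [vp hp ->]]]; last exact: path_set_connect.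
have: exists p, [/\ path_seq l p, head 1 p = head 1 l & path_set l l = path_set l p].
  by exists l; split=> //; exact: path_seq_self.
elim: s (path_set l l) hs => [|D1 s IH] D0 //= /andP[mv hs] [p [vp hp eD]].
apply: IH => //; rewrite eD in mv.
by have [q [vq hq ->]] := excited_move_path _ _ _ pl vp mv; exists q; rewrite hq.
Qed.

Lemma path_set_inj l p q : is_partition l -> path_seq l p -> path_seq l q ->
  head 1 p = head 1 q -> path_set l p = path_set l q -> p = q.
Proof.
move=> pl vp vq hpq /setP eqD.
wlog suff hle : p q vp vq hpq eqD / forall i, i < size l -> nth 1 q i <= nth 1 p i.
  case/path_seqP: (vp) => sp _; case/path_seqP: (vq) => sq _.
  apply: (@eq_from_nth _ 1); rewrite sp ?sq // => i hi.
  by apply/eqP; rewrite eqn_leq !hle //.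
case/path_seqP: (vp) => sp hp; case/path_seqP: (vq) => sq hq.
case=> [|i] hi; first by rewrite !nth0 hpq.
rewrite leqNgt; apply/negP => lt.
have p0 := path_seq_gt0 _ _ i.+1 vp.
have li := partition_nth l i pl.
have hqi := hq _ hi; have hpi := hp _ (ltnW hi).
(* The cell where [p] enters the row is on [p], but to the left of [q] and hence off it. *)
have cl : in_diagram l (i.+1, nth 1 p i.+1) by rewrite in_diagramS; lia.
have [c hc] := in_diagram_cell _ _ pl cl.
have := eqD c; rewrite !inE hc /path_cell cl /path_cond /=; lia.
Qed.

(** * Naruse-Newton coefficients as path sums *)

Lemma big_diagram (T : Type) (idx : T) (op : Monoid.com_law idx) l
    (P : pred (nat * nat)) (F : nat * nat -> T) : is_partition l ->
  \big[op/idx]_(c : cell l | in_diagram l (cnat c) && P (cnat c)) F (cnat c) =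
  \big[op/idx]_(0 <= i < size l)
    \big[op/idx]_(1 <= j < (nth 0 l i).+1 | P (i.+1, j)) F (i.+1, j).
Proof.
move=> pl; rewrite big_mkcond /=.
rewrite -(pair_bigA _ (fun i j : 'I_(cbound l) =>
  if in_diagram l (i : nat, j : nat) && P (i : nat, j : nat)
  then F (i : nat, j : nat) else idx)) /=.
rewrite -(big_mkord xpredT (fun i => \big[op/idx]_(j < cbound l)
  if in_diagram l (i, j : nat) && P (i, j : nat) then F (i, j : nat) else idx)).
(* Row 0, the rows past [size l] and, below, the columns outside [1..nth 0 l i] contribute the
   neutral element. *)
rewrite big_ltn // big1 ?Monoid.mul1m //.
rewrite big_add1 /= (@big_cat_nat _ _ _ (size l)) //=; last by rewrite leq_addr.
rewrite [X in op _ X]big_nat [X in op _ X]big1 ?Monoid.mulm1; last first.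
  move=> i hi; apply: big1 => j _; case: ifP => // /andP[/in_diagram_row h _]; exfalso; lia.
rewrite !big_nat; apply: eq_bigr => i hi.
rewrite -(big_mkord xpredT (fun j =>
  if in_diagram l (i.+1, j) && P (i.+1, j) then F (i.+1, j) else idx)).
have hle := partition_nth_head _ i pl.
rewrite big_ltn //= Monoid.mul1m (@big_cat_nat _ _ _ (nth 0 l i).+1) //=; last first.
  by rewrite /cbound; lia.
rewrite [X in op _ X]big_nat [X in op _ X]big1 ?Monoid.mulm1; last first.
  by move=> j hj; case: ifP => // /andP[]; rewrite in_diagramS => h _; exfalso; lia.
rewrite [RHS]big_mkcond !big_nat; apply: eq_bigr => j hj.
by rewrite in_diagramS (_ : 0 < j <= _); last by lia.
Qed.

Lemma row1_count_path x l q : is_partition (x :: l) -> head 1 q <= x ->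
  row1_count (path_set (x :: l) (x :: q)) = head 1 q - 1.
Proof.
move=> pl hq; rewrite /row1_count -sum1_card.
rewrite (eq_bigl (fun c => in_diagram (x :: l) (cnat c) &&
  (path_cond (x :: q) (cnat c).1.-1 (cnat c).2 && ((cnat c).1 == 1)))); last first.
  by move=> c; rewrite !inE andbA.
rewrite (@big_diagram _ _ addn (x :: l)
  (fun c => path_cond (x :: q) c.1.-1 c.2 && (c.1 == 1)) (fun _ => 1)) //.
rewrite big_ltn //= [X in _ + X]big_nat [X in _ + X]big1 ?addn0; last first.
  by move=> [|i] // _; apply: big_pred0 => j; rewrite andbF.
transitivity (\sum_(1 <= j < head 1 q) 1); last by rewrite sum_nat_const_nat muln1.
rewrite (@big_nat_widen _ _ _ _ (head 1 q) x.+1) ?(leq_trans hq) //=.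
rewrite big_nat_cond [RHS]big_nat_cond; apply: eq_bigl => j.
by rewrite /path_cond /= nth0; lia.
Qed.

Lemma prod_hook_path x l q : is_partition (x :: l) ->
  \prod_(c in path_set (x :: l) (x :: q) | (cnat c).1 != 1) hook (x :: l) (cnat c) =
  path_weight l q.
Proof.
move=> pl.
rewrite (eq_bigl (fun c => in_diagram (x :: l) (cnat c) &&
  (path_cond (x :: q) (cnat c).1.-1 (cnat c).2 && ((cnat c).1 != 1)))); last first.
  by move=> c; rewrite !inE andbA.
rewrite (@big_diagram _ _ muln (x :: l)
  (fun c => path_cond (x :: q) c.1.-1 c.2 && (c.1 != 1)) (hook (x :: l))) //.
rewrite big_ltn //= [X in X * _]big1 ?mul1n; last by move=> j; rewrite andbF.
rewrite -(@path_weight_shift x l (x :: q) q) // !big_nat.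
by apply: eq_bigr => -[|i] // _; apply: eq_bigl => j; rewrite andbT.
Qed.

(** The path leaves row 1 in its last column [x], so it is determined by its part [q] in [l]. Row 1
    of the diagram then has [head 1 q - 1] cells, and there are x - 1 - j of them exactly when [q]
    ends in column [x - j]. *)
Lemma NNcoef_path_sum x l m j : is_partition (x :: l) ->
  (forall c, in_diagram m c = in_diagram (x :: l) c && ~~ outer (x :: l) c) ->
  head 1 l <= x -> j < x ->
  NNcoef (x :: l) m j = path_sum l (x - j).
Proof.
move=> pl hm hlx hj; rewrite /NNcoef /path_sum /s_of [part _ _]/=.
have hcons q : path_seq (x :: l) (x :: q) = path_seq l q.
  rewrite path_seq_cons leqnn andbT andb_idl //.
  case: q => [|y q]; first by move=> _ /=; move: pl; rewrite is_partition_cons => /and3P[].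
  case: l hlx {pl hm} => // z l; rewrite path_seq_cons /= => hz /andP[h _]; lia.
have inj : {in paths l (x - j) &, injective (fun q => path_set (x :: l) (x :: q))}.
  move=> q r; rewrite !mem_paths => /andP[vq _] /andP[vr _] e.
  suff [] : x :: q = x :: r by [].
  by apply: (path_set_inj (x :: l)); rewrite ?hcons.
rewrite -big_enum_cond -big_filter.
under [RHS]eq_bigr => q _ do rewrite -(@prod_hook_path x l q pl).
rewrite -[RHS](big_map (fun q => path_set (x :: l) (x :: q)) xpredT
  (fun D => \prod_(c in D | (cnat c).1 != 1) hook (x :: l) (cnat c))).
apply: perm_big; apply: uniq_perm.
- by rewrite filter_uniq // enum_uniq.
- by rewrite map_inj_in_uniq // paths_uniq.
move=> D; rewrite mem_filter mem_enum.
apply/andP/mapP => [[/eqP rc /(mem_excited_diagrams _ _ _ pl hm)[[|k q] []]]|[q]].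
- by move/path_seqP=> [].
- move=> vp /= kx eD; subst k D; rewrite row1_count_path // in rc; last first.
    by move: vp; rewrite path_seq_cons; lia.
  exists q => //; rewrite mem_paths -hcons vp /=; apply/eqP.
  have := path_seq_gt0 _ _ 1 vp; rewrite /= nth0; lia.
rewrite mem_paths => /andP[vq /eqP hq] ->; split.
  by rewrite row1_count_path // hq; first (apply/eqP; lia); lia.
by apply/(mem_excited_diagrams _ _ _ pl hm); exists (x :: q); rewrite hcons.
Qed.

(** * Comparison of consecutive coefficients *)

Lemma w_of_cons x l : is_partition [:: x, x & l] -> w_of [:: x, x & l] = x - head 0 l.
Proof.
rewrite !is_partition_cons => /and3P[x0 _ /and3P[_ hx pl]].
rewrite /w_of /s_of [part _ _]/= -sum1_count.
have -> : iota 1 (x - 1).+1 = index_iota 1 x.+1 by rewrite /index_iota !subn1 prednK.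
(* Each column up to [x] meets both rows of length [x], so it has two cells exactly when it lies
   beyond the first row of [l]. *)
transitivity (\sum_((head 0 l).+1 <= j < x.+1) 1); last by rewrite sum_nat_const_nat muln1 subSS.
rewrite (big_nat_widenl (head 0 l).+1 1) //.
rewrite big_nat_cond [RHS]big_nat_cond; apply: eq_bigl => j.
apply: andb_id2l => /andP[j0 jx]; rewrite !conj_part_cons // !eqSS conj_part_eq0 //.
Qed.

(** For [k.+2 = x - j] the factor [x - k.+1] is j + 1, and the hook in the recurrence is this factor
    plus the leg. *)
Lemma path_sum_step x l k : is_partition (x :: l) -> k.+1 < x ->
  (conj_part l k.+2 == 0 ->
     (x - k.+1) * path_sum (x :: l) k.+2 = path_sum (x :: l) k.+1) /\
  (0 < conj_part l k.+2 ->
     path_sum (x :: l) k.+1 < (x - k.+1) * path_sum (x :: l) k.+2).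
Proof.
move=> pl hk.
have pl' : is_partition l by move: pl; rewrite is_partition_cons => /and3P[].
have := path_sum_rec _ _ _ pl hk; rewrite hook_cons1 // addn1 -addSn subnSK // mulnDl.
move=> rec; split=> [/eqP c0|c0].
  move: rec; rewrite c0 (path_sum_out l) ?muln0 ?addn0 //.
  (* For empty [l], [path_sum_out] compares with the default 1, which is still below [k.+2]. *)
  by move/eqP: c0; rewrite conj_part_eq0 //; case: (l).
have := path_sum_lt x l k.+2 pl hk c0; lia.
Qed.

Lemma fact_ratio_eq (a b j : nat) : j.+1 * a = b ->
  (a%:R / (j`!)%:R = b%:R / (j.+1`!)%:R :> rat)%R.
Proof.
move=> <-; rewrite factS !natrM -mulf_div divff ?mul1r //.
by rewrite pnatr_eq0.
Qed.

Lemma fact_ratio_lt (a b j : nat) : b < j.+1 * a ->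
  (b%:R / (j.+1`!)%:R < a%:R / (j`!)%:R :> rat)%R.
Proof.
move=> h; rewrite (fact_ratio_eq a _ j erefl) ltr_pM2r ?ltr_nat //.
by rewrite invr_gt0 ltr0n fact_gt0.
Qed.

Local Open Scope fset_scope.

Theorem theorem4p5 (I : {fset nat}) (lam mu : seq nat) :
  I != fset0 -> (forall i, i \in I -> 0 < i) ->
  (* lam = lambda^I *)
  is_partition lam -> part lam 1 = part lam 2 -> ribbon_of (outer lam) I ->
  (* mu = mu^I : D(lambda^I) minus the ribbon *)
  is_partition mu -> (forall c, in_diagram mu c = in_diagram lam c && ~~ outer lam c) ->
  (forall j, (j < minn (w_of lam) (s_of lam))%N ->
     ((NNcoef lam mu j)%:R / (j`!)%:R = (NNcoef lam mu j.+1)%:R / (j.+1`!)%:R :> rat)%R) /\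
  (forall j, (w_of lam <= j < s_of lam)%N ->
     ((NNcoef lam mu j.+1)%:R / (j.+1`!)%:R < (NNcoef lam mu j)%:R / (j`!)%:R :> rat)%R).
Proof.
move=> _ _ plam e12 _ _ hmu; have [s0|s0] := posnP (s_of lam).
  by rewrite s0 minn0; split=> // j; rewrite andbF.
case: lam plam e12 hmu s0 => [|x [|y l]] //= plam.
  by move=> x0; move: plam; rewrite x0.
move=> exy; subst y => hmu; rewrite w_of_cons // /s_of [part _ _]/= => s0.
have pxl : is_partition (x :: l) by move: plam; rewrite is_partition_cons => /and3P[].
have pl : is_partition l by move: pxl; rewrite is_partition_cons => /and3P[].
have step j : j < x - 1 -> exists2 k, x - j = k.+2 & x - j.+1 = k.+1.
  by move=> hj; exists (x - j - 2); lia.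
split=> j hj.
  have hjx : j < x - 1 by lia.
  have [k ek ek'] := step j hjx.
  apply: fact_ratio_eq; rewrite !(NNcoef_path_sum x (x :: l)) //; try lia.
  have hk : k.+1 < x by lia.
  have [h _] := path_sum_step x l k pxl hk.
  (* The bound j < w says that column [x - j] lies beyond the first row of [l], so its leg is
     zero. *)
  rewrite ek ek' -h; last by rewrite conj_part_eq0 //; lia.
  by congr muln; lia.
have hjx : j < x - 1 by lia.
have [k ek ek'] := step j hjx.
apply: fact_ratio_lt; rewrite !(NNcoef_path_sum x (x :: l)) //; try lia.
have hk : k.+1 < x by lia.
have [_ h] := path_sum_step x l k pxl hk.
rewrite ek ek'; have -> : j.+1 = x - k.+1 by lia.
by apply: h; rewrite lt0n conj_part_eq0 // -leqNgt; lia.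
Qed.
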